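(* Let $r>0$ be a real number, let $k\ge 0$ be an integer, and let $X\subset Y$ be an inclusion of finite metric spaces such that $d_H(X^{k}_{dis},Y^{k}_{dis})<r$. Then the diagram of layer posets and poset morphisms consisting of $i_\ast:\mathrm{L}_k(X)\to \mathrm{L}_k(Y)$, $\theta_\ast:\mathrm{L}_k(Y)\to \mathrm{L}_k(X)$, $\sigma_\ast:\mathrm{L}_k(X)\to \mathrm{L}_k(X)$ and $\sigma_\ast:\mathrm{L}_k(Y)\to \mathrm{L}_k(Y)$ is homotopy commutative, in the sense that $$\theta_\ast\cdot i_\ast\le \sigma_\ast:\mathrm{L}_k(X)\to \mathrm{L}_k(X)\quad\text{and}\quad i_\ast\cdot\theta_\ast\le\sigma_\ast:\mathrm{L}_k(Y)\to \mathrm{L}_k(Y),$$ where these relations between poset morphisms hold pointwise.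
   Context: For a finite metric space $(X,d)$, an integer $k\ge 0$ and $s\in[0,\infty]$, the degree Rips complex $L_{s,k}(X)$ is the simplicial complex whose simplices are the non-empty subsets $\tau\subset X$ such that $d(x,x')\le s$ for all $x,x'\in\tau$ and each $x\in\tau$ has at least $k$ distinct neighbours $y\in X$ (with $y\neq x$) such that $d(x,y)\le s$. For $s\le t$ there is an inclusion $\sigma: L_{s,k}(X)\subset L_{t,k}(X)$. For a vertex $x$ of $L_{s,k}(X)$, $[x]$ or $[x]_s$ denotes its path component, regarded both as an element of $\pi_0L_{s,k}(X)$ and as a subset of $X$ (the set of vertices in that component). The poset $\Gamma_k(X)$ has elements the pairs $(s,[x])$ with $s\in[0,\infty]$ and $[x]\in\pi_0L_{s,k}(X)$, with $(s,[x])\le(t,[y])$ if and only if $s\le t$ and $[x]=[y]$ in $\pi_0L_{t,k}(X)$ (equivalently $s\le t$ and $[x]_s\subset[y]_t$). A layer point of $\Gamma_k(X)$ is an element $(t,[x])$ such that either 1) whenever $(s,[y])\le(t,[x])$ with $s<t$, the set $[y]_s$ is a proper subset of $[x]_t$, or 2) there is no relation $(s,[y])\le(t,[x])$ with $s<t$. The layer points form the subposet $\mathrm{L}_k(X)\subset\Gamma_k(X)$. Every element of $\Gamma_k(X)$ has a unique largest layer point below it, and $\max:\Gamma_k(X)\to \mathrm{L}_k(X)$ is the poset morphism taking an element to the largest layer point below it. $X^k_{dis}$ denotes the set of $(k+1)$-tuples of distinct elements of $X$; for $X\subset Y$ the Hausdorff distance $d_H(X^k_{dis},Y^k_{dis})$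 is computed in $Y^k_{dis}$ with the metric $d((y_i),(y_i'))=\max_i d(y_i,y'_i)$. Under the assumption $d_H(X^k_{dis},Y^k_{dis})<r$, the (known) degree Rips stability theorem provides maps $\theta:L_{s,k}(Y)\to L_{s+2r,k}(X)$, natural in $s$, such that $\theta\cdot i$ and $i\cdot\theta$ are homotopic to the inclusions $\sigma:L_{s,k}(X)\to L_{s+2r,k}(X)$ and $\sigma:L_{s,k}(Y)\to L_{s+2r,k}(Y)$ respectively, where $i$ is induced by $X\subset Y$. On path components this gives functions $\theta:\pi_0L_{s,k}(Y)\to\pi_0L_{s+2r,k}(X)$, $[y]\mapsto[\theta(y)]$, natural in $s$, with $\theta\cdot i=\sigma$ and $i\cdot\theta=\sigma$ on path components. Such a $\theta$ is fixed. There are induced poset morphisms $i:\Gamma_k(X)\to\Gamma_k(Y)$, $(s,[x])\mapsto(s,[i(x)])$; $\theta:\Gamma_k(Y)\to\Gamma_k(X)$, $(s,[y])\mapsto(s+2r,[\theta(y)])$; and $\sigma:(s,[x])\mapsto(s+2r,[x])$ on each of $\Gamma_k(X)$ and $\Gamma_k(Y)$. The maps $i_\ast,\theta_\ast,\sigma_\ast$ on layer posets are the restrictions of $\max\cdot i$, $\max\cdot\theta$, $\max\cdot\sigma$ to layer points. For example, $i_\ast(s,[x])$ is the largest layer point of $\Gamma_k(Y)$ below $(s,[i(x)])$. *)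

(* Defs.v *)
From HB Require Import structures.
From mathcomp Require Import all_boot all_order all_algebra.
From mathcomp Require Import all_classical all_reals.
From mathcomp Require Import ereal topology metric_structure.

Set Implicit Arguments.
Unset Strict Implicit.
Unset Printing Implicit Defensive.

Import Order.TTheory GRing.Theory Num.Theory.

Local Open Scope ring_scope.

#[short(type="finMetricType")]
HB.structure Definition FinMetric (R : numDomainType) :=
  { M of Finite M & Metric R M }.

Section Rips.
Context {R : realType} (T : finMetricType R) (k : nat).
Implicit Types (s t u : \bar R) (x y z : T) (A : {set T}).

Definition dle s x y : bool := ((mdist x y)%:E <= s)%E.

(* [simplex s A]: A is a simplex of the degree Rips complex L_{s,k}(T). *)
Definition simplex s A : bool :=
  [&& A != finset.set0,
      [forall x in A, forall y in A, dle s x y] &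
      [forall x in A, (k <= #|[set y | (y != x) && dle s x y]|)%N]].

Definition vertex s x : bool := simplex s [set x]%SET.

Definition edge s x y : bool := simplex s [set x; y]%SET.

Definition path_component s x : {set T} := [set y | connect (edge s) x y]%SET.

(* pi_0 of L_{s,k}(T): a path component is represented by its set of
   vertices. There is no vertex, hence no component, when s < 0. *)
Definition pi0 s : Type :=
  {C : {set T} | [exists x, vertex s x && (C == path_component s x)]}.

Lemma dle_sym s x y : dle s x y = dle s y x.
Proof. by rewrite /dle metric_sym. Qed.

Lemma dle_le s t x y : (s <= t)%E -> dle s x y -> dle t x y.
Proof. by move=> st /le_trans; apply. Qed.

Lemma simplexP s A :
  reflect [/\ A != finset.set0,
     {in A &, forall x y, dle s x y} &
     {in A, forall x, (k <= #|[set y | (y != x) && dle s x y]|)%N}]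
    (simplex s A).
Proof.
apply: (iffP and3P) => -[A0 h1 h2]; split => //.
- by move=> x y xA yA; move/forall_inP: h1 => /(_ x xA)/forall_inP; apply.
- by move=> x xA; move/forall_inP: h2; apply.
- by apply/forall_inP => x xA; apply/forall_inP => y yA; apply: h1.
- by apply/forall_inP.
Qed.

Lemma simplex_le s t A : (s <= t)%E -> simplex s A -> simplex t A.
Proof.
move=> st /simplexP[A0 h1 h2]; apply/simplexP; split => //.
  by move=> x y xA yA; apply: dle_le st _; exact: h1.
move=> x xA; apply: leq_trans (h2 _ xA) _; apply: subset_leq_card.
apply/fintype.subsetP => y; rewrite !inE => /andP[-> /=]; exact: dle_le.
Qed.

Lemma simplex_sub s (A B : {set T}) :
  B != finset.set0 -> B \subset A -> simplex s A -> simplex s B.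
Proof.
move=> B0 /fintype.subsetP BA /simplexP[_ h1 h2]; apply/simplexP; split => //.
- by move=> x y /BA ? /BA ?; apply: h1.
- by move=> x /BA; apply: h2.
Qed.

Lemma simplex_vertex s A x : x \in A -> simplex s A -> vertex s x.
Proof.
move=> xA; apply: simplex_sub; last by rewrite finset.sub1set.
by apply/set0Pn; exists x; rewrite inE.
Qed.

Lemma edge_sym s : symmetric (edge s).
Proof. by move=> x y; rewrite /edge finset.setUC. Qed.

Lemma edge_connect_sym s : connect_sym (edge s).
Proof. exact/sym_connect_sym/edge_sym. Qed.

Lemma path_componentP s x y :
  reflect (path_component s x = path_component s y) (connect (edge s) x y).
Proof.
apply: (iffP idP) => [xy|e]; last first.
  have : y \in path_component s y by rewrite inE connect0.
  by rewrite -e inE.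
apply/setP => z; rewrite !inE.
exact: (same_connect (@edge_connect_sym s) xy).
Qed.

Lemma connect_vertex s x y : connect (edge s) x y -> vertex s x -> vertex s y.
Proof.
case/connectP => p; elim: p x => [x _ -> //|z p IH x /= /andP[xz zp] e _].
apply: (IH z) => //; apply: simplex_vertex xz; by rewrite !inE eqxx orbT.
Qed.

Lemma pi0_class_subproof s x (vx : vertex s x) :
  [exists y, vertex s y && (path_component s x == path_component s y)].
Proof. by apply/existsP; exists x; rewrite vx eqxx. Qed.

Definition pi0_class s x (vx : vertex s x) : pi0 s :=
  exist _ (path_component s x) (pi0_class_subproof vx).

Definition pi0_repr s (c : pi0 s) : T := xchoose (existsP (svalP c)).

Lemma pi0_reprP s (c : pi0 s) :
  vertex s (pi0_repr c) /\ sval c = path_component s (pi0_repr c).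
Proof. by have /andP[? /eqP] := xchooseP (existsP (svalP c)). Qed.

Lemma pi0_repr_vertex s (c : pi0 s) : vertex s (pi0_repr c).
Proof. by case: (pi0_reprP c). Qed.

Lemma pi0_inj s (c c' : pi0 s) : sval c = sval c' -> c = c'.
Proof. exact: val_inj. Qed.

Lemma pi0_mem s (c : pi0 s) x :
  x \in sval c -> vertex s x /\ sval c = path_component s x.
Proof.
have [v ->] := pi0_reprP c; rewrite inE => cx; split.
  exact: connect_vertex cx v.
exact/path_componentP.
Qed.

Lemma pi0_repr_mem s (c : pi0 s) : pi0_repr c \in sval c.
Proof. by have [_ ->] := pi0_reprP c; rewrite inE connect0. Qed.

End Rips.

Definition isometric_embedding (R : realType) (T T' : finMetricType R) (f : T -> T') :=
  forall x y, mdist (f x) (f y) = mdist x y.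

Definition simplicial (R : realType) (T T' : finMetricType R) (k : nat)
    (f : T -> T') (s t : \bar R) :=
  forall A : {set T}, simplex k s A -> simplex k t (f @: A)%SET.

Section InducedMap.
Context {R : realType} (T T' : finMetricType R) (k : nat) (f : T -> T').
Context (s t : \bar R) (fS : simplicial k f s t).

Lemma simplicial_vertex x : vertex k s x -> vertex k t (f x).
Proof. by move=> /fS; rewrite imset_set1. Qed.

Lemma simplicial_connect x y :
  connect (edge k s) x y -> connect (edge k t) (f x) (f y).
Proof.
case/connectP => p; elim: p x => [x _ -> //|z p IH x /= /andP[xz zp] e].
apply: connect_trans (IH _ zp e); apply: connect1.
by move: xz => /fS; rewrite /edge imsetU1 imset_set1.
Qed.

(* [x] |-> [f x] *)
Definition pi0_map (c : pi0 T k s) : pi0 T' k t :=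
  pi0_class (simplicial_vertex (pi0_repr_vertex c)).

Lemma pi0_mapE (c : pi0 T k s) x :
  x \in sval c -> sval (pi0_map c) = path_component k t (f x).
Proof.
move=> xc; rewrite /pi0_map /=; apply/path_componentP.
apply: simplicial_connect; apply/path_componentP.
by have [_ <-] := pi0_reprP c; have [_ <-] := pi0_mem xc.
Qed.

Lemma pi0_map_mem (c : pi0 T k s) x : x \in sval c -> f x \in sval (pi0_map c).
Proof. by move=> /pi0_mapE ->; rewrite inE connect0. Qed.

End InducedMap.

Lemma simplicial_le (R : realType) (T : finMetricType R) k (s t : \bar R) :
  (s <= t)%E -> simplicial k (@id T) s t.
Proof. by move=> st A; rewrite imset_id; exact: simplex_le. Qed.

Definition pi0_sigma (R : realType) (T : finMetricType R) (k : nat)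
    (s t : \bar R) (st : (s <= t)%E) : pi0 T k s -> pi0 T k t :=
  pi0_map (@simplicial_le R T k s t st).

Lemma simplicial_isometry (R : realType) (X Y : finMetricType R) (k : nat)
    (i : X -> Y) (s : \bar R) : isometric_embedding i -> simplicial k i s s.
Proof.
move=> iI A /simplexP[A0 h1 h2].
have inj : injective i.
  by move=> x y e; apply: mdist_positivity; rewrite -iI e mdistxx.
have cl x y : dle s (i x) (i y) = dle s x y by rewrite /dle iI.
apply/simplexP; split.
- by case/set0Pn: A0 => x xA; apply/set0Pn; exists (i x); exact: imset_f.
- by move=> _ _ /imsetP[x xA ->] /imsetP[y yA ->]; rewrite cl; exact: h1.
- move=> _ /imsetP[x xA ->]; apply: leq_trans (h2 _ xA) _.
  rewrite -(card_imset _ inj); apply/subset_leq_card/fintype.subsetP => z.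
  by move=> /imsetP[y + ->]; rewrite !inE cl (inj_eq inj).
Qed.

Section Gamma.
Context {R : realType} (T : finMetricType R) (k : nat).

Record gamma := Gamma {
  gscale : \bar R;
  gscale_ge0 : (0 <= gscale)%E;
  gcomp : pi0 T k gscale }.

HB.instance Definition _ := gen_eqMixin gamma.
HB.instance Definition _ := gen_choiceMixin gamma.

(* (s,[x]) <= (t,[y]) iff s <= t and [x] = [y] in pi_0 L_{t,k}(T);
   [gamma_leP] is the equivalent form with [x]_s included in [y]_t. *)
Definition gamma_le (p q : gamma) : bool :=
  `[< exists st : (gscale p <= gscale q)%E,
        pi0_sigma st (gcomp p) = gcomp q >].

Lemma gamma_leP (p q : gamma) :
  reflect ((gscale p <= gscale q)%E /\ sval (gcomp p) \subset sval (gcomp q))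
          (gamma_le p q).
Proof.
apply: (iffP (asboolP _)) => [[st <-]|[st pq]].
  split=> //; apply/fintype.subsetP => x; exact: pi0_map_mem.
exists st; apply: pi0_inj.
rewrite (pi0_mapE _ (pi0_repr_mem _)).
by have [_ ->] := pi0_mem (fintype.subsetP pq _ (pi0_repr_mem _)).
Qed.

Lemma gamma_eq (p q : gamma) :
  gscale p = gscale q -> sval (gcomp p) = sval (gcomp q) -> p = q.
Proof.
case: p q => [s s0 c] [t t0 c'] /= st; subst t => cc.
by rewrite (pi0_inj cc) (bool_irrelevance s0 t0).
Qed.

Fact gamma_le_refl : reflexive gamma_le.
Proof. by move=> p; apply/gamma_leP. Qed.

Fact gamma_le_anti : antisymmetric gamma_le.
Proof.
move=> p q /andP[/gamma_leP[s1 c1] /gamma_leP[s2 c2]]; apply: gamma_eq.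
  by apply/eqP; rewrite eq_le s1 s2.
by apply/eqP; rewrite finset.eqEsubset c1 c2.
Qed.

Fact gamma_le_trans : transitive gamma_le.
Proof.
move=> q p r /gamma_leP[s1 c1] /gamma_leP[s2 c2]; apply/gamma_leP; split.
  exact: le_trans s1 s2.
exact: fintype.subset_trans c1 c2.
Qed.

Fact gamma_display : Order.disp_t. Proof. exact: Order.Disp tt tt. Qed.

HB.instance Definition _ := Order.Le_isPOrder.Build gamma_display gamma
  gamma_le_refl gamma_le_anti gamma_le_trans.

Lemma gammaP (p q : gamma) :
  reflect ((gscale p <= gscale q)%E /\ sval (gcomp p) \subset sval (gcomp q))
          (p <= q)%O.
Proof. exact: gamma_leP. Qed.

Definition layer_point (p : gamma) : Prop :=
  (forall q : gamma, (q <= p)%O -> (gscale q < gscale p)%E ->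
     sval (gcomp q) \proper sval (gcomp p))
  \/ ~ (exists q : gamma, (q <= p)%O /\ (gscale q < gscale p)%E).

Definition layer : Type := {p : gamma | `[< layer_point p >]}.

HB.instance Definition _ := Choice.on layer.
HB.instance Definition _ := SubType.on layer.
HB.instance Definition _ := [SubChoice_isSubPOrder of layer by <: with gamma_display].

(* L_{s,k}(T) only changes when s crosses one of these finitely many values. *)
Definition critical (o : option (T * T)) : \bar R :=
  if o is Some (x, y) then (mdist x y)%:E else 0%E.

Lemma critical_ge0 o : (0 <= critical o)%E.
Proof. by case: o => [[x y]|] //=; rewrite lee_fin mdist_ge0. Qed.

Lemma critical_floor (s : \bar R) : (0 <= s)%E ->
  exists2 o, (critical o <= s)%E &
    forall x y : T, dle (critical o) x y = dle s x y.
Proof.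
move=> s0.
case: (@Order.TotalTheory.arg_maxP _ _ _ None
  (fun o => critical o <= s)%E critical s0) => o os omax.
exists o => // x y; apply/idP/idP; first exact: dle_le os.
by move=> /(omax (Some (x, y))).
Qed.

Lemma simplex_ext (s t : \bar R) (A : {set T}) :
  (forall x y : T, dle s x y = dle t x y) -> simplex k s A = simplex k t A.
Proof.
move=> e; rewrite /simplex; congr [&& _, _ & _].
  by apply: eq_forallb_in => x _; apply: eq_forallb_in => y _.
apply: eq_forallb_in => x _; congr (_ <= _)%N.
by apply: eq_card => y; rewrite !inE e.
Qed.

Lemma path_component_ext (s t : \bar R) (x : T) :
  (forall x y : T, dle s x y = dle t x y) ->
  path_component k s x = path_component k t x.
Proof.
move=> e; apply/setP => y; rewrite !inE.
by apply: eq_connect => a b; rewrite /edge (simplex_ext _ e).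
Qed.

Lemma ex_largest_layer (p : gamma) :
  exists q : layer, (val q <= p)%O /\
    forall q' : layer, (val q' <= p)%O -> (q' <= q)%O.
Proof.
pose C := sval (gcomp p).
pose P o := (critical o <= gscale p)%E &&
  [exists x, vertex k (critical o) x && (C == path_component k (critical o) x)].
have ex (s : \bar R) (s0 : (0 <= s)%E) (c : pi0 T k s) :
    (s <= gscale p)%E -> sval c = C -> exists2 o, P o & (critical o <= s)%E.
  move=> sp cC; have [o os oE] := critical_floor s0.
  exists o => //; rewrite /P (le_trans os sp) /=.
  have [v e] := pi0_reprP c; apply/existsP; exists (pi0_repr c).
  rewrite /vertex in v *.
  by rewrite (simplex_ext _ oE) v -cC e (path_component_ext _ oE) /=.
have [o0 Po0 _] := ex _ (gscale_ge0 p) (gcomp p) (lexx _) erefl.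
case: (@Order.TotalTheory.arg_minP _ _ _ o0 P critical Po0) => o /andP[op oC] omin.
pose q := Gamma (critical_ge0 o) (exist _ C oC : pi0 T k (critical o)).
have lq : layer_point q.
  left=> q' /gammaP[_ q'q] q's; rewrite finset.properEneq q'q andbT.
  apply/eqP => e.
  have [o' Po' o's] := ex _ (gscale_ge0 q') _ (le_trans (ltW q's) op) e.
  by have := le_lt_trans (le_trans (omin _ Po') o's) q's; rewrite ltxx.
exists (exist _ q (asboolT lq)); split; first exact/gammaP.
move=> q'1; have := valP q'1; rewrite -Order.le_val /=.
move: (val q'1) => {q'1} q' /asboolP lq' /gammaP[q's q'c].
apply/gammaP; split=> //.
rewrite leNgt; apply/negP => lt.
have qq' : (q <= q')%O.
  apply/gammaP; split; first exact: ltW.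
  have xq' := pi0_repr_mem (gcomp q').
  have xC := fintype.subsetP q'c _ xq'.
  have [_ ->] := pi0_mem xq'.
  have [_ e] := pi0_mem (xC : _ \in sval (gcomp q)).
  rewrite [sval _]e; apply/fintype.subsetP => z; rewrite !inE.
  exact: (@simplicial_connect _ _ _ _ id _ _ (simplicial_le (ltW lt))).
case: lq' => [/(_ _ qq' lt)|[]]; last by exists q.
by move=> /fintype.proper_sub_trans /(_ q'c); rewrite fintype.properxx.
Qed.

Definition lmax (p : gamma) : layer := sval (cid (ex_largest_layer p)).

Lemma lmax_le (p : gamma) : (val (lmax p) <= p)%O.
Proof. by have [] := svalP (cid (ex_largest_layer p)). Qed.

Lemma lmax_largest (p : gamma) (q : layer) :
  (val q <= p)%O -> (q <= lmax p)%O.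
Proof. by have [_] := svalP (cid (ex_largest_layer p)); apply. Qed.

Fact lmax_homo : {homo lmax : p q / (p <= q)%O}.
Proof. by move=> p q pq; apply/lmax_largest/(le_trans (lmax_le p) pq). Qed.

HB.instance Definition _ :=
  Order.isOrderMorphism.Build _ gamma _ layer lmax lmax_homo.

End Gamma.

(* f_* : the restriction of max . f to layer points. *)
Definition layer_map (R : realType) (T T' : finMetricType R) (k k' : nat)
    (f : {omorphism gamma T k -> gamma T' k'}) :
    {omorphism layer T k -> layer T' k'} :=
  (@lmax R T' k' \o f) \o val.

Definition scale_shift (R : realType) (r : R) (s : \bar R) : \bar R :=
  (s + (2 * r)%:E)%E.

Lemma le_shift (R : realType) (r : R) (s : \bar R) :
  0 < r -> (s <= scale_shift r s)%E.
Proof. by move=> r0; rewrite leeDl// lee_fin mulr_ge0// ltW. Qed.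

Lemma shift_le (R : realType) (r : R) (s t : \bar R) :
  (s <= t)%E -> (scale_shift r s <= scale_shift r t)%E.
Proof. by move=> st; rewrite leeD2r. Qed.

Section Diagram.
Context {R : realType} (r : R) (k : nat) (X Y : finMetricType R) (i : X -> Y).
Hypotheses (r_gt0 : 0 < r) (iI : isometric_embedding i).

Definition pi0_i (s : \bar R) : pi0 X k s -> pi0 Y k s :=
  pi0_map (@simplicial_isometry R X Y k i s iI).

(* What the degree Rips stability theorem yields on path components. Indices
   s < 0 carry no information, since pi0 is then empty. *)
Record stability_map := StabilityMap {
  theta : forall s : \bar R, pi0 Y k s -> pi0 X k (scale_shift r s);
  theta_natural : forall (s t : \bar R) (st : (s <= t)%E) (c : pi0 Y k s),
    theta (pi0_sigma st c) = pi0_sigma (shift_le r st) (theta c);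
  theta_i : forall (s : \bar R) (c : pi0 X k s),
    theta (pi0_i c) = pi0_sigma (le_shift s r_gt0) c;
  i_theta : forall (s : \bar R) (c : pi0 Y k s),
    pi0_i (theta c) = pi0_sigma (le_shift s r_gt0) c }.

Definition gamma_i (p : gamma X k) : gamma Y k :=
  Gamma (gscale_ge0 p) (pi0_i (gcomp p)).

Definition gamma_theta (th : stability_map) (p : gamma Y k) : gamma X k :=
  Gamma (le_trans (gscale_ge0 p) (le_shift (gscale p) r_gt0))
        (theta th (gcomp p)).

Definition gamma_sigma (T : finMetricType R) (p : gamma T k) : gamma T k :=
  Gamma (le_trans (gscale_ge0 p) (le_shift (gscale p) r_gt0))
        (pi0_sigma (le_shift (gscale p) r_gt0) (gcomp p)).

Lemma pi0_sub_mapE (T : finMetricType R) (s t : \bar R) (st : (s <= t)%E)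
    (c : pi0 T k s) (c' : pi0 T k t) :
  sval c \subset sval c' -> pi0_sigma st c = c'.
Proof.
move=> cc'; apply: pi0_inj; rewrite (pi0_mapE _ (pi0_repr_mem c)).
by have [_ ->] := pi0_mem (fintype.subsetP cc' _ (pi0_repr_mem c)).
Qed.

Fact gamma_i_homo : {homo gamma_i : p q / (p <= q)%O}.
Proof.
move=> p q /gammaP[st cc]; apply/gammaP; split=> //.
have xp := pi0_repr_mem (gcomp p).
have xq := fintype.subsetP cc _ xp.
rewrite [sval (gcomp (gamma_i p))](pi0_mapE _ xp).
rewrite [sval (gcomp (gamma_i q))](pi0_mapE _ xq); apply/fintype.subsetP => z.
rewrite !inE; exact: (simplicial_connect (simplicial_le st)).
Qed.

Fact gamma_theta_homo (th : stability_map) :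
  {homo gamma_theta th : p q / (p <= q)%O}.
Proof.
move=> p q /gammaP[st cc]; apply/gammaP; split=> /=; first exact: shift_le.
rewrite -(pi0_sub_mapE st cc) theta_natural.
by apply/fintype.subsetP => x; exact: pi0_map_mem.
Qed.

Fact gamma_sigma_homo (T : finMetricType R) :
  {homo @gamma_sigma T : p q / (p <= q)%O}.
Proof.
move=> p q /gammaP[st cc]; apply/gammaP; split; first exact: shift_le.
have xp := pi0_repr_mem (gcomp p).
have xq := fintype.subsetP cc _ xp.
rewrite [sval (gcomp (gamma_sigma p))](pi0_mapE _ xp).
rewrite [sval (gcomp (gamma_sigma q))](pi0_mapE _ xq); apply/fintype.subsetP => z.
rewrite !inE; exact: (simplicial_connect (simplicial_le (shift_le r st))).
Qed.

HB.instance Definition _ :=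
  Order.isOrderMorphism.Build _ _ _ _ gamma_i gamma_i_homo.
HB.instance Definition _ (th : stability_map) :=
  Order.isOrderMorphism.Build _ _ _ _ (gamma_theta th) (gamma_theta_homo th).
HB.instance Definition _ (T : finMetricType R) :=
  Order.isOrderMorphism.Build _ _ _ _ (@gamma_sigma T) (@gamma_sigma_homo T).

End Diagram.

(* The max metric; 0 is a harmless unit, distances being non-negative. *)
Definition tuple_dist (R : realType) (T : finMetricType R) (n : nat)
    (u v : n.-tuple T) : R :=
  \big[Num.max/0]_(j < n) mdist (tnth u j) (tnth v j).

(* Both extrema range over finite sets; the conventions sup {} = 0 and
   inf {} = +oo give distance 0 between two empty sets and +oo between an
   empty and a non-empty one. *)
Definition hausdorff_dist (R : realType) (U : finType) (dist : U -> U -> R)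
    (A B : {set U}) : \bar R :=
  maxe (\big[maxe/0%E]_(a in A) \big[mine/+oo%E]_(b in B) (dist a b)%:E)
       (\big[maxe/0%E]_(b in B) \big[mine/+oo%E]_(a in A) (dist a b)%:E).

(* (k+1)-tuples, for T^k_dis *)
Definition distinct_tuples (T : finType) (k : nat) : {set k.+1.-tuple T} :=
  [set u : k.+1.-tuple T | uniq u]%SET.

(* d_H(X^k_dis, Y^k_dis) in Y^k_dis, X being viewed in Y through i. *)
Definition hausdorff_dis (R : realType) (X Y : finMetricType R) (i : X -> Y)
    (k : nat) : \bar R :=
  hausdorff_dist (@tuple_dist R Y k.+1)
    [set map_tuple i u | u in distinct_tuples X k]%SET
    (distinct_tuples Y k).

(* Main.v *)
Require Import Defs.
From mathcomp Require Import all_boot all_order all_algebra.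
From mathcomp Require Import all_classical all_reals.

(** Already on the posets [gamma] both composites of [i] and theta are equal
    to sigma: this is the compatibility of theta with [i] on path components,
    the scale being shifted by [2 * r] on either side. On layer posets, a
    composite of induced maps takes the largest layer point twice,
    [max (g (max (f p)))], where the map induced by the composite takes
    it once, [max (g (f p))]. Since [max q <= q], and [g] and [max] are
    monotone, the additional truncation can only make the result smaller.
    This is why an equality becomes an inequality ([layer_map_comp_le]). *)

(** The intermediate truncation to a layer point can only lose height, so that
    [layer_map] is a lax functor. *)
Lemma layer_map_comp_le (R : realType) (T T' T'' : finMetricType R)
    (k k' k'' : nat) (f : {omorphism gamma T k -> gamma T' k'})
    (g : {omorphism gamma T' k' -> gamma T'' k''})
    (h : {omorphism gamma T k -> gamma T'' k''}) :
  (forall p, (g (f p) <= h p)%O) ->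
  forall p : layer T k, (layer_map g (layer_map f p) <= layer_map h p)%O.
Proof.
move=> gfh p; apply: lmax_homo; apply: Order.POrderTheory.le_trans (gfh _).
by apply: Order.OrderMorphismTheory.omorph_le; exact: lmax_le.
Qed.

Lemma gamma_theta_i (R : realType) (r : R) (r_gt0 : (0 < r)%R) (k : nat)
    (X Y : finMetricType R) (i : X -> Y) (iI : isometric_embedding i)
    (th : stability_map k r_gt0 iI) (p : gamma X k) :
  gamma_theta th (gamma_i iI p) = gamma_sigma r_gt0 p.
Proof. by apply: gamma_eq => //; rewrite [gcomp (gamma_theta _ _)]theta_i. Qed.

Lemma gamma_i_theta (R : realType) (r : R) (r_gt0 : (0 < r)%R) (k : nat)
    (X Y : finMetricType R) (i : X -> Y) (iI : isometric_embedding i)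
    (th : stability_map k r_gt0 iI) (p : gamma Y k) :
  gamma_i iI (gamma_theta th p) = gamma_sigma r_gt0 p.
Proof.
by apply: gamma_eq => //; rewrite [gcomp (gamma_i _ _)](i_theta th (gcomp p)).
Qed.

Theorem theorem8 (R : realType) (r : R) (r_gt0 : (0 < r)%R) (k : nat)
    (X Y : finMetricType R) (i : X -> Y) (iI : isometric_embedding i)
    (dH : (hausdorff_dis i k < r%:E)%E) (th : stability_map k r_gt0 iI) :
  let i_star := layer_map (gamma_i (k := k) iI) in
  let theta_star := layer_map (gamma_theta th) in
  let sigma_star (T : finMetricType R) :=
    layer_map (@gamma_sigma R r k r_gt0 T) in
  (forall p : layer X k,
     (theta_star (i_star p) <= sigma_star X p)%O) /\
  (forall p : layer Y k,
     (i_star (theta_star p) <= sigma_star Y p)%O).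
Proof.
split; apply: layer_map_comp_le => p /=.
  by rewrite gamma_theta_i.
by rewrite gamma_i_theta.
Qed.
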